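(* Let $u=u_1\cdots u_r$ be an allowed word of $\Sigma_A$ with $r\ge2$ and let $\mathcal G=\{u\}$. Then $$\det(\mathbf I-z\,B_{\mathcal G}\circ P_{r-1})=f_u(z),\qquad\text{where } f_u(z)=\tilde\tau_u(z)\det(\mathbf I-zP)+z^{r-1}\delta_u\big(\operatorname{adj}(\mathbf I-zP)\big)_{u_ru_1}.$$
   Context: Let $\Sigma=\{1,\dots,N\}$, $A$ an irreducible $N\times N$ $0$–$1$ matrix, $\Sigma_A=\{x\in\Sigma^{\mathbb N}:A_{x_nx_{n+1}}=1\ \forall n\}$; $\mathcal L_n$ is the set of allowed words of length $n$ (occurring in some element of $\Sigma_A$). $P$ is a row-stochastic matrix with $P_{ij}>0$ iff $A_{ij}=1$. For $X=x_1\cdots x_n,Y=y_1\cdots y_n\in\mathcal L_n$ with $x_2\cdots x_n=y_1\cdots y_{n-1}$ (vacuous if $n=1$), $X*Y=x_1\cdots x_ny_n$. $P_n$ is indexed by $\mathcal L_n$ with $(P_n)_{XY}=P_{x_ny_n}$ if $X*Y$ is defined and lies in $\mathcal L_{n+1}$, and $0$ otherwise. $B_{\{u\}}$ is the $0$–$1$ matrix indexed by $\mathcal L_{r-1}$ with entry $1$ at $(X,Y)$ iff $X*Y$ is defined, lies in $\mathcal L_r$, and $X*Y\ne u$ (for $r-1\ge1$; when $r=2$ this is indexed by $\Sigma=\mathcal L_1$). $\circ$ is the Hadamard product, $\operatorname{adj}$ the adjugate. $\delta_u=P_{u_1u_2}\cdots P_{u_{r-1}u_r}$; for $0\le s\le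 r-1$, $c_{s,u,u}=1$ if $u_{s+1}\cdots u_r=u_1\cdots u_{r-s}$ and $0$ otherwise, $\delta_{s,u,u}=\prod_{j=r-s}^{r-1}P_{u_ju_{j+1}}$ (empty product $=1$), $\tau_u(z)=\sum_{s=0}^{r-1}c_{s,u,u}\delta_{s,u,u}z^s$, and $\tilde\tau_u(z)=\tau_u(z)-z^{r-1}c_{r-1,u,u}\delta_u$. *)

(* Defs.v *)
From HB Require Import structures.
From mathcomp Require Import all_boot all_order all_algebra.
From mathcomp Require Import boolp.
Set Implicit Arguments. Unset Strict Implicit. Unset Printing Implicit Defensive.
Import Order.TTheory GRing.Theory Num.Theory.
Local Open Scope ring_scope.

(* Alphabet Sigma = {1,...,N} is represented by 'I_N (symbol k <-> ordinal k-1).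
   Words are sequences over 'I_N. *)

Definition irreducible (R : numDomainType) (N : nat) (A : 'M[R]_N) : Prop :=
  forall i j, exists n : nat, (0 < n)%N /\ 0 < (A ^+ n) i j.

Definition allowed (R : numDomainType) (N : nat) (A : 'M[R]_N) (w : seq 'I_N) : Prop :=
  exists x : nat -> 'I_N, (forall k, A (x k) (x k.+1) = 1) /\
    exists m : nat, w = mkseq (fun i => x (m + i)) (size w).

Notation Lw A n := {w : n.-tuple _ | `[< allowed A (tval w) >]}.

(* A matrix indexed by a finite type, realised as a square matrix over 'I_#|T|
   via the enumeration of T (the determinant does not depend on the ordering). *)
Definition fmx (K : Type) (T : finType) (F : T -> T -> K) : 'M[K]_#|T| :=
  \matrix_(i, j) F (enum_val i) (enum_val j).

Definition hadamard (K : pzSemiRingType) (m n : nat) (M1 M2 : 'M[K]_(m, n)) :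
  'M[K]_(m, n) := \matrix_(i, j) (M1 i j * M2 i j).

Definition star_def (T : eqType) (X Y : seq T) : bool :=
  behead X == take (size Y).-1 Y.

Definition star (T : Type) (X Y : seq T) : seq T :=
  match Y with [::] => X | y :: ys => rcons X (last y ys) end.

Definition lastS (T : Type) (s : seq T) : option T := ohead (rev s).

Definition Pn (R : numDomainType) (N : nat) (A P : 'M[R]_N) (n : nat) :
  'M[R]_#|{: Lw A n}| :=
  fmx (fun X Y : Lw A n =>
    match lastS (tval (val X)), lastS (tval (val Y)) with
    | Some xn, Some yn =>
        if star_def (val X) (val Y) && `[< allowed A (star (val X) (val Y)) >]
        then P xn yn else 0
    | _, _ => 0
    end).

Definition Bu (R : numDomainType) (N : nat) (A : 'M[R]_N) (u : seq 'I_N) (n : nat) :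
  'M[R]_#|{: Lw A n}| :=
  fmx (fun X Y : Lw A n =>
    if [&& star_def (val X) (val Y), `[< allowed A (star (val X) (val Y)) >]
         & star (val X) (val Y) != u] then 1 else 0).

Definition delta_u (R : numDomainType) (N : nat) (P : 'M[R]_N) (u : seq 'I_N) : R :=
  \prod_(p <- zip u (behead u)) P p.1 p.2.

Definition c_suu (N : nat) (u : seq 'I_N) (s : nat) : bool :=
  drop s u == take (size u - s) u.

Definition delta_suu (R : numDomainType) (N : nat) (P : 'M[R]_N) (u : seq 'I_N) (s : nat) : R :=
  \prod_(p <- zip (drop (size u - s - 1) u) (drop (size u - s) u)) P p.1 p.2.

Definition tau_u (R : numDomainType) (N : nat) (P : 'M[R]_N) (u : seq 'I_N) : {poly R} :=
  \sum_(s < size u) ((c_suu u s)%:R * delta_suu P u s) *: 'X^s.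

Definition tilde_tau_u (R : numDomainType) (N : nat) (P : 'M[R]_N) (u : seq 'I_N) : {poly R} :=
  tau_u P u - 'X^((size u).-1) * ((c_suu u (size u).-1)%:R * delta_u P u)%:P.

Definition entry_last_first (K : nzRingType) (N : nat) (M : 'M[K]_N) (u : seq 'I_N) : K :=
  match u with [::] => 0 | a :: s => M (last a s) a end.

Definition IzP (R : numDomainType) (N : nat) (P : 'M[R]_N) : 'M[{poly R}]_N :=
  1%:M - 'X *: map_mx polyC P.

Definition f_u (R : numDomainType) (N : nat) (P : 'M[R]_N) (u : seq 'I_N) : {poly R} :=
  tilde_tau_u P u * \det (IzP P)
  + 'X^((size u).-1) * (delta_u P u)%:P * entry_last_first (\adj (IzP P)) u.

(* Main.v *)
Require Import Defs.
From HB Require Import structures.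
From mathcomp Require Import all_boot all_order all_algebra.
From mathcomp Require Import boolp.
Set Implicit Arguments. Unset Strict Implicit. Unset Printing Implicit Defensive.
Import Order.TTheory GRing.Theory Num.Theory.
Local Open Scope ring_scope.

(** The words of length [n + 1] factor the transfer matrices: with [S] selecting
    suffixes and [T] weighted prefixes, [P_(n+1) = S T] and [P_n = T S].  Hence
    [det (1 - z P_n)] is the same polynomial [D = det (1 - z P)] for every [n],
    and [(1 - S T)^-1 = 1 + S (1 - T S)^-1 T] gives, for
    [G_n = adj (1 - z P_n)], the recursion
      [G_(n+1)(W, W') = D [W = W'] + z P_(w'_n w'_(n+1)) G_n(suffix W, prefix W')],
    which unrolls to the overlap polynomial times [D] plus a multiple of an entry
    of [G_1 = adj (1 - z P)].  Forbidding [u] deletes a single entry of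
    [P_(r-1)], so the determinant changes by one entry of [G_(r-1)]; by the same
    recursion the result is exactly [G_r(u, u)]. *)

Lemma sum_pick (V : pzRingType) (I : finType) (k : I) (p : pred I) (F : I -> V) :
  (forall i, p i = (i == k)) -> \sum_i (p i)%:R * F i = F k.
Proof.
move=> h; rewrite (bigD1 k) //= h eqxx mul1r big1 ?addr0 // => i /negPf e.
by rewrite h e mul0r.
Qed.

(** * Determinant identities over a commutative ring *)

Section MatrixIdentities.
Variables (K : comNzRingType).

(** Multiplying the same two block matrices in either order gives block triangular matrices whose
    determinants are the two sides. *)
Lemma det_sub1_mulmxC (m n : nat) (S : 'M[K]_(m, n)) (T : 'M[K]_(n, m)) :
  \det (1%:M - S *m T) = \det (1%:M - T *m S).
Proof.
have h1 : block_mx 1%:M S T 1%:M *m block_mx 1%:M 0 (- T) 1%:M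
          = block_mx (1%:M - S *m T) S 0 1%:M.
  by rewrite mulmx_block !mulmx1 !mul1mx !mulmx0 !mulmxN !add0r subrr.
have h2 : block_mx 1%:M 0 (- T) 1%:M *m block_mx 1%:M S T 1%:M
          = block_mx 1%:M S 0 (1%:M - T *m S).
  rewrite mulmx_block !mulmx1 !mul1mx !mul0mx !mulNmx !addr0 addNr.
  by rewrite [- _ + _]addrC.
have := congr1 determinant h1; have := congr1 determinant h2.
by rewrite !det_mulmx !det_ublock !det_lblock !det1 !mulr1 !mul1r => ->.
Qed.

(** The cofactors along row [i] do not involve row [i], so the determinant is affine in the entry
    [(i, j)], with its cofactor as slope. *)
Lemma det_add_delta (n : nat) (M : 'M[K]_n) (i j : 'I_n) (c : K) :
  \det (M + c *: delta_mx i j) = \det M + c * \adj M j i.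
Proof.
rewrite (expand_det_row _ i) (expand_det_row M i) mxE.
under eq_bigr => k _.
  have -> : cofactor (M + c *: delta_mx i j) i k = cofactor M i k.
    rewrite /cofactor; congr (_ * \det _); apply/matrixP=> a b.
    by rewrite !mxE eq_sym (negPf (neq_lift _ _)) mulr0 addr0.
  rewrite !mxE eqxx mulrDl; over.
rewrite big_split /=; congr (_ + _).
rewrite (bigD1 j) //= eqxx mulr1 big1 ?addr0 // => k /negPf ->.
by rewrite mulr0 mul0r.
Qed.

End MatrixIdentities.

(** * Determinant and adjugate of [1 - zM] *)

Section CharacteristicMatrices.
Variables (R : numDomainType).

(** At [z = 0] the matrix is the identity. Being nonzero, the determinant can be cancelled in the
    domain of polynomials. *)
Lemma det_IzP_neq0 (n : nat) (M : 'M[R]_n) : \det (IzP M) != 0.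
Proof.
apply/eqP=> d0; have : (\det (IzP M)).[0] = 1.
  rewrite -horner_evalE -det_map_mx (_ : map_mx _ _ = 1%:M) ?det1 //.
  apply/matrixP=> i j; rewrite !mxE /= horner_evalE !hornerE.
  by case: (i == j); rewrite ?hornerC ?horner0 subr0.
by rewrite d0 horner0 => /esym/eqP; rewrite oner_eq0.
Qed.

Lemma IzP_mul (m n : nat) (S : 'M[R]_(m, n)) (T : 'M[R]_(n, m)) :
  IzP (S *m T) = 1%:M - map_mx polyC S *m ('X *: map_mx polyC T).
Proof. by rewrite /IzP map_mxM scalemxAr. Qed.

Lemma IzP_mulC (m n : nat) (S : 'M[R]_(m, n)) (T : 'M[R]_(n, m)) :
  IzP (T *m S) = 1%:M - ('X *: map_mx polyC T) *m map_mx polyC S.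
Proof. by rewrite /IzP map_mxM scalemxAl. Qed.

Lemma det_IzP_mulC (m n : nat) (S : 'M[R]_(m, n)) (T : 'M[R]_(n, m)) :
  \det (IzP (S *m T)) = \det (IzP (T *m S)).
Proof. by rewrite IzP_mul IzP_mulC det_sub1_mulmxC. Qed.

(* The adjugate form of [(1 - S T)^-1 = 1 + S (1 - T S)^-1 T]. *)
Lemma adj_IzP_mulC (m n : nat) (S : 'M[R]_(m, n)) (T : 'M[R]_(n, m)) :
  \adj (IzP (S *m T)) = (\det (IzP (T *m S)))%:M
     + map_mx polyC S *m \adj (IzP (T *m S)) *m ('X *: map_mx polyC T).
Proof.
set D := \det _; set H := (X in _ = X).
have DE : \det (IzP (S *m T)) = D by rewrite det_IzP_mulC.
have HE : IzP (S *m T) *m H = D%:M.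
  have hadj := mul_mx_adj (IzP (T *m S)); rewrite -/D in hadj.
  rewrite {}/H; move: (\adj (IzP (T *m S))) hadj => B.
  rewrite (IzP_mul S T) (IzP_mulC S T).
  move: (map_mx polyC S) ('X *: map_mx polyC T) => s t.
  rewrite mulmxBl mul1mx => hadj.
  have {}hadj : B = D%:M + t *m s *m B by rewrite -hadj subrK.
  rewrite mulmxDr mulmxBl mul1mx mulmxBl mul1mx !mul_mx_scalar.
  (* Here [hadj] is substituted once for [B]; the second summand then cancels in
     [(1 - st)(D + sBt)]. *)
  have {1}-> : s *m B *m t = D *: (s *m t) + s *m t *m (s *m B *m t).
    rewrite {1}hadj mulmxDr mulmxDl mul_mx_scalar scalemxAl.
    by rewrite !mulmxA.
  by rewrite addrK subrK.
have hD : D != 0 by rewrite -DE det_IzP_neq0.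
have : D *: H = D *: \adj (IzP (S *m T)).
  by rewrite -mul_scalar_mx -{1}DE -mul_adj_mx -mulmxA HE mul_mx_scalar.
move/matrixP=> e; apply/matrixP=> i j; have := e i j.
by rewrite mxE [RHS]mxE => /(mulfI hD).
Qed.

End CharacteristicMatrices.

(** * Allowed words as matrix indices *)

Section Words.
Variables (R : numDomainType) (N : nat) (A P : 'M[R]_N) (x0 : 'I_N).
Hypothesis P_ge0 : forall i j, 0 <= P i j.
Hypothesis P_row : forall i, \sum_j P i j = 1.
Hypothesis P_supp : forall i j, 0 < P i j <-> A i j = 1.

Let edge : rel 'I_N := fun a b => A a b == 1.

Lemma P_eq0 i j : ~~ edge i j -> P i j = 0.
Proof.
move=> /negP e; have := P_ge0 i j; rewrite le_eqVlt.
by case/orP=> [/eqP<-//|/P_supp/eqP].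
Qed.

Lemma edge_succ i : exists j, edge i j.
Proof.
apply/existsP/negbNE/negP=> /existsPn h.
have := P_row i; rewrite big1 => [/esym/eqP|j _]; first by rewrite oner_eq0.
by rewrite P_eq0 // h.
Qed.

(** Allowedness becomes a local condition: since every letter has a successor, a path in the graph
    extends to an infinite sequence in which it occurs at position 0. *)
Lemma allowedP w : reflect (allowed A w) (sorted edge w).
Proof.
apply: (iffP idP) => [/(sortedP x0) sw|[x [hx [m ->]]]]; last first.
  apply/(sortedP x0) => i; rewrite size_mkseq => hi.
  have hi' := ltnW hi; rewrite !nth_mkseq //.
  (* In [allowed], [m + i] is the ring addition of [nat], so [addnS] only applies
     up to conversion. *)
  rewrite (_ : m + i.+1 = (m + i)%N.+1); last exact: addnS.
  by apply/eqP; exact: hx.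
have [succ succP] := boolp.choice edge_succ.
(* The [.+1] makes the first letter after [w] a successor of the last letter of [w]; for empty [w]
   the sequence starts at [succ x0]. *)
pose x k := if (k < size w)%N then nth x0 w k
            else iter (k - size w).+1 succ (last x0 w).
exists x; split=> [k|]; last first.
  exists 0; apply: (@eq_from_nth _ x0); rewrite ?size_mkseq // => i hi.
  by rewrite nth_mkseq // /x add0r hi.
apply/eqP; rewrite /x; have [h1|h1|h1] := ltngtP k.+1 (size w).
- exact: sw.
- by rewrite subSn //; exact: succP.
- by rewrite -h1 subnn -nth_last -h1; exact: succP.
Qed.

Definition word n (i : 'I_#|{: Lw A n}|) : seq 'I_N := tval (val (enum_val i)).

Lemma size_word n (i : 'I_#|{: Lw A n}|) : size (word i) = n.
Proof. exact: size_tuple. Qed.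

Lemma sorted_word n (i : 'I_#|{: Lw A n}|) : sorted edge (word i).
Proof. by apply/allowedP; have /asboolP := valP (enum_val i). Qed.

Lemma word_inj n : injective (@word n).
Proof. by move=> i j /val_inj/val_inj/enum_val_inj. Qed.

Lemma word_surj n w : size w = n -> sorted edge w -> exists i, @word n i = w.
Proof.
move=> /eqP sw /allowedP /asboolP aw.
by exists (enum_rank (exist _ (Tuple sw) aw)); rewrite /word enum_rankK.
Qed.

Lemma starE (X Y : seq 'I_N) : (0 < size Y)%N -> star X Y = rcons X (last x0 Y).
Proof. by case: Y. Qed.

Lemma lastSE (s : seq 'I_N) : (0 < size s)%N -> lastS s = Some (last x0 s).
Proof. by case/lastP: s => // s x _; rewrite /lastS rev_rcons last_rcons. Qed.

Lemma allowed_star n (i j : 'I_#|{: Lw A n.+1}|) :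
  `[< allowed A (star (word i) (word j)) >]
  = edge (last x0 (word i)) (last x0 (word j)).
Proof.
rewrite starE ?size_word //; apply/asboolP/idP.
  move/allowedP; have := size_word i.
  by case: (word i) => // a s _; rewrite /= rcons_path => /andP[].
move=> e; apply/allowedP; have := sorted_word i; have := size_word i.
by move: e; case: (word i) => //= a s e _; rewrite rcons_path e andbT.
Qed.

Lemma Pn_word n (i j : 'I_#|{: Lw A n.+1}|) :
  Pn A P n.+1 i j = (behead (word i) == take n (word j))%:R
                    * P (last x0 (word i)) (last x0 (word j)).
Proof.
rewrite mxE -!/(word _) !lastSE ?size_word // allowed_star.
rewrite /star_def size_word /=; case: eqP => _ /=; rewrite ?mul0r ?mul1r //.
by case: ifP => // /negbT /P_eq0.
Qed.

Lemma Bu_word u n (i j : 'I_#|{: Lw A n.+1}|) :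
  Bu A u n.+1 i j = [&& behead (word i) == take n (word j),
    edge (last x0 (word i)) (last x0 (word j))
    & rcons (word i) (last x0 (word j)) != u]%:R.
Proof.
rewrite mxE -!/(word _) allowed_star starE ?size_word //.
by rewrite /star_def size_word /=; case: ifP.
Qed.

(** Both sides say that [W] is [X * Y] with [X] and [Y] overlapping in all but one letter. *)
Lemma split_word_eq n (W X Y : seq 'I_N) :
  size W = n.+2 -> size X = n.+1 -> size Y = n.+1 ->
  (take n.+1 W == X) && (behead W == Y)
  = (W == rcons X (last x0 Y)) && (behead X == take n Y).
Proof.
case/lastP: W => // -[//|a V] y; rewrite size_rcons => -[sV].
case: X => // c X; case/lastP: Y => // Y b; rewrite size_rcons => -[sX] [sY].
rewrite -!cats1 take_cat /= sV ltnn subnn take0 cats0 take_size_cat //.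
rewrite !cats1 last_rcons !eqseq_cons !eqseq_rcons.
case: (V =P X) => [->|_] /=; last by rewrite !andbF.
by rewrite andbT -andbA [(X == Y) && _]andbC.
Qed.

(** * Factorisation of the transfer matrices through suffixes and prefixes *)

Definition suffix_mx n : 'M[R]_(#|{: Lw A n.+2}|, #|{: Lw A n.+1}|) :=
  \matrix_(i, j) (behead (word i) == word j)%:R.

(** Only this factor carries weights, so each of the two products has exactly one factor [P]. *)
Definition prefix_mx n : 'M[R]_(#|{: Lw A n.+1}|, #|{: Lw A n.+2}|) :=
  \matrix_(i, j) ((take n.+1 (word j) == word i)%:R
                  * P (last x0 (word i)) (last x0 (word j))).

Lemma suffix_word n (i : 'I_#|{: Lw A n.+1}|) :
  exists k : 'I_#|{: Lw A n}|, word k = behead (word i).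
Proof.
apply: word_surj; first by rewrite size_behead size_word.
by rewrite -drop1; apply: drop_sorted; exact: sorted_word.
Qed.

Lemma prefix_word n (i : 'I_#|{: Lw A n.+1}|) :
  exists k : 'I_#|{: Lw A n}|, word k = take n (word i).
Proof.
apply: word_surj; first by rewrite size_takel ?size_word.
by apply: take_sorted; exact: sorted_word.
Qed.

Lemma suffix_mul_prefix n : suffix_mx n *m prefix_mx n = Pn A P n.+2.
Proof.
apply/matrixP=> i j; rewrite [LHS]mxE Pn_word.
have [k hk] := suffix_word i; under eq_bigr do rewrite !mxE.
rewrite (sum_pick (k := k)) => [|l].
  rewrite hk eq_sym; congr (_ * P _ _); have := size_word i.
  by case: (word i) => [|a []].
by rewrite -hk eq_sym; apply/eqP/eqP=> [/word_inj|->].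
Qed.

Lemma prefix_mul_suffix n : prefix_mx n *m suffix_mx n = Pn A P n.+1.
Proof.
apply/matrixP=> i j; rewrite [LHS]mxE Pn_word.
set c := (X in _ = X); set w := rcons (word i) (last x0 (word j)).
transitivity (\sum_k (@word n.+2 k == w)%:R * c).
  apply: eq_bigr => k _; rewrite !mxE mulrAC -natrM mulnb.
  rewrite split_word_eq ?size_word // -mulnb natrM -mulrA /c.
  case: eqP => [->|_]; last by rewrite !mul0r.
  by rewrite last_rcons.
(* If [X * Y] is not allowed it is no index of the sum, but then its weight is zero as well. *)
case e: (edge (last x0 (word i)) (last x0 (word j))); last first.
  have -> : c = 0 by rewrite /c P_eq0 ?e // mulr0.
  by rewrite big1 // => k _; rewrite mulr0.
have [k hk] : exists k : 'I_#|{: Lw A n.+2}|, word k = w.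
  apply: word_surj; first by rewrite size_rcons size_word.
  have := sorted_word i; have := size_word i; rewrite /w; move: e.
  by case: (word i) => //= a s e _; rewrite rcons_path e andbT.
rewrite (sum_pick (k := k)) // => l.
by rewrite -hk; apply/eqP/eqP=> [/word_inj|->].
Qed.

Lemma det_IzP_step n : \det (IzP (Pn A P n.+2)) = \det (IzP (Pn A P n.+1)).
Proof. by rewrite -suffix_mul_prefix det_IzP_mulC prefix_mul_suffix. Qed.

(** Entrywise form of [adj_IzP_mulC]: row [i] of the suffix matrix selects [k], column [j] of the
    prefix matrix selects [l]. *)
Lemma adj_IzP_step n (i j : 'I_#|{: Lw A n.+2}|) (k l : 'I_#|{: Lw A n.+1}|) :
  word k = behead (word i) -> word l = take n.+1 (word j) ->
  \adj (IzP (Pn A P n.+2)) i j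
  = \det (IzP (Pn A P n.+1)) *+ (i == j)
    + 'X * (P (last x0 (word l)) (last x0 (word j)))%:P
         * \adj (IzP (Pn A P n.+1)) k l.
Proof.
move=> hk hl; rewrite -suffix_mul_prefix adj_IzP_mulC prefix_mul_suffix.
move: (\adj _) (\det _) => G D; rewrite !mxE; congr (_ + _).
transitivity (\sum_l' (take n.+1 (word j) == word l')%:R
    * ((map_mx polyC (suffix_mx n) *m G) i l'
       * ('X * (P (last x0 (word l')) (last x0 (word j)))%:P))).
  apply: eq_bigr => l' _.
  by rewrite !mxE polyCM polyC_natr ['X * _]mulrCA; exact: mulrCA.
rewrite (sum_pick (k := l)) => [|l']; last first.
  by rewrite -hl eq_sym; apply/eqP/eqP=> [/word_inj|->].
rewrite mulrC mxE; congr (_ * _).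
under eq_bigr => k' _ do rewrite !mxE polyC_natr.
rewrite (sum_pick (k := k)) // => k'.
by rewrite -hk eq_sym; apply/eqP/eqP=> [/word_inj|->].
Qed.

(** * Passage from words of length one to letters *)

Lemma one_letter_word (a : 'I_N) : exists k : 'I_#|{: Lw A 1}|, word k = [:: a].
Proof. exact: word_surj. Qed.

Lemma last_word1_inj : injective (fun i : 'I_#|{: Lw A 1}| => last x0 (word i)).
Proof.
move=> i j /= e; apply: word_inj; move: e (size_word i) (size_word j).
by case: (word i) => [|a []] //; case: (word j) => [|b []] //= ->.
Qed.

(** [Pn A P 1] and [P] have different index types; factoring through letters lets the same product
    identities relate them. *)
Definition letter_mx : 'M[R]_(#|{: Lw A 1}|, N) :=
  \matrix_(i, y) (y == last x0 (word i))%:R.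

Definition from_letter_mx : 'M[R]_(N, #|{: Lw A 1}|) :=
  \matrix_(x, j) P x (last x0 (word j)).

Lemma letter_mul_from : letter_mx *m from_letter_mx = Pn A P 1.
Proof.
apply/matrixP=> i j; rewrite [LHS]mxE Pn_word.
under eq_bigr do rewrite !mxE.
rewrite (sum_pick (k := last x0 (word i))) // take0.
by have := size_word i; case: (word i) => [|a []] //=; rewrite mul1r.
Qed.

Lemma from_mul_letter : from_letter_mx *m letter_mx = P.
Proof.
apply/matrixP=> x y; rewrite !mxE; under eq_bigr do rewrite !mxE mulrC.
have [k hk] := one_letter_word y.
rewrite (sum_pick (k := k)) ?hk // => l.
by rewrite eq_sym -[y]/(last x0 [:: y]) -hk (inj_eq last_word1_inj).
Qed.

Lemma det_IzP_Pn n : \det (IzP (Pn A P n.+1)) = \det (IzP P).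
Proof.
elim: n => [|n IHn]; last by rewrite det_IzP_step.
by rewrite -letter_mul_from det_IzP_mulC from_mul_letter.
Qed.

Lemma adj_IzP_Pn1 (i j : 'I_#|{: Lw A 1}|) :
  \adj (IzP (Pn A P 1)) i j = \adj (IzP P) (last x0 (word i)) (last x0 (word j)).
Proof.
rewrite -letter_mul_from adj_IzP_mulC from_mul_letter -mulmxA.
set a := last x0 (word i); set b := last x0 (word j).
(* This is an entry of [adj(1 - zP)(1 - zP) = D]; its last term cancels the product term of
   [adj_IzP_mulC]. *)
have e : \det (IzP P) *+ (a == b)
         = \adj (IzP P) a b - (\adj (IzP P) *m ('X *: map_mx polyC P)) a b.
  have -> : \det (IzP P) *+ (a == b) = (\det (IzP P))%:M a b by rewrite [RHS]mxE.
  by rewrite -mul_adj_mx {2}/IzP mulmxBr mulmx1 [LHS]mxE [X in _ + X = _]mxE.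
rewrite mxE [_%:M i j]mxE -(inj_eq last_word1_inj) -/a -/b e [X in _ + X = _]mxE.
transitivity (\adj (IzP P) a b - (\adj (IzP P) *m ('X *: map_mx polyC P)) a b
  + \sum_k (k == a)%:R
      * (\adj (IzP P) *m ('X *: map_mx polyC from_letter_mx)) k j).
  by congr (_ + _); apply: eq_bigr => k _; rewrite !mxE polyC_natr.
rewrite (sum_pick (k := a)) // -addrA -[RHS]addr0; congr (_ + _).
apply/eqP; rewrite addrC subr_eq0 !mxE; apply/eqP/eq_bigr => k _.
by rewrite !mxE.
Qed.

(** * Overlap polynomials and the unrolled recursion *)

(** Two-word version of the truncated correlation polynomial: the top shift [s = size X - 1] is left
    out. *)
Definition overlap_poly (Y X : seq 'I_N) : {poly R} :=
  \sum_(s < (size X).-1)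
    ((drop s Y == take (size X - s) X)%:R * delta_suu P X s) *: 'X^s.

Lemma delta_u_rcons (s : seq 'I_N) y : (0 < size s)%N ->
  delta_u P (rcons s y) = delta_u P s * P (last x0 s) y.
Proof.
case: s => //= a s _; elim: s a => [|b s IHs] a.
  by rewrite /delta_u big_seq1 big_nil mul1r.
by move: (IHs b); rewrite /delta_u /= !big_cons => ->; rewrite mulrA.
Qed.

Lemma delta_suuE (X : seq 'I_N) s : (s < size X)%N ->
  delta_suu P X s = delta_u P (drop (size X - s - 1) X).
Proof.
move=> hs; rewrite /delta_suu /delta_u -drop1 drop_drop.
by rewrite addnC subnK // subn_gt0.
Qed.

Lemma tilde_tau_uE (u : seq 'I_N) : (0 < size u)%N ->
  tilde_tau_u P u = overlap_poly u u.
Proof.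
rewrite /tilde_tau_u /tau_u /overlap_poly; case hm: (size u) => [//|m] _ /=.
rewrite big_ord_recr /= delta_suuE ?hm // subSnn subnn drop0.
rewrite -[_ *: 'X^_]mul_polyC ['X^_ * _]mulrC addrK.
by apply: eq_bigr => s _; rewrite /c_suu hm.
Qed.

(** [delta_suu P X s] weighs the last [s] transitions of [X], so a new last letter adds one
    factor. *)
Lemma delta_suu_rcons (X : seq 'I_N) y s : (s < size X)%N ->
  delta_suu P (rcons X y) s.+1 = delta_suu P X s * P (last x0 X) y.
Proof.
move=> hs; rewrite !delta_suuE ?size_rcons // subSS.
have hk : (size X - s - 1 < size X)%N.
  by rewrite -subnDA ltn_subrL addn1 (leq_ltn_trans _ hs).
rewrite drop_rcons; last exact: ltnW.
rewrite delta_u_rcons ?size_drop ?subn_gt0 //; congr (_ * P _ _).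
rewrite -[in RHS](cat_take_drop (size X - s - 1) X) last_cat.
case: (drop _ X) (size_drop (size X - s - 1) X) hk => //= /esym/eqP.
by rewrite subn_eq0 leqNgt => /negP.
Qed.

(** Shift 0 compares the whole words; shift [s + 1] of [W] is shift [s] of its suffix. This matches
    the recursion for the adjugate entries. *)
Lemma overlap_poly_rcons n (W X : seq 'I_N) y :
  size W = n.+2 -> size X = n.+1 ->
  overlap_poly W (rcons X y) = (W == rcons X y)%:R
    + 'X * (P (last x0 X) y)%:P * overlap_poly (behead W) X.
Proof.
move=> sW sX; rewrite /overlap_poly size_rcons sX /= big_ord_recl; congr (_ + _).
  rewrite drop0 subn0 take_oversize ?size_rcons ?sX // expr0.
  have -> : delta_suu P (rcons X y) 0 = 1.
    by rewrite /delta_suu subn0 drop_size; case: (drop _ _) => *; rewrite big_nil.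
  by rewrite mulr1 scaler_nat.
rewrite mulr_sumr; apply: eq_bigr => s _.
have hs : (s < size X)%N by rewrite sX ltnS ltnW.
rewrite lift0 subSS -addn1 -drop_drop drop1 addn1 delta_suu_rcons //.
rewrite -cats1 takel_cat ?sX ?leq_subr //.
rewrite mulrA -scalerA -scalerAr; congr (_ *: _).
by rewrite exprS -mul_polyC mulrA [_%:P * 'X]mulrC.
Qed.

(** Induction on the length: each step adds an overlap term and one transition weight, until
    one-letter words leave an entry of [adj(1 - zP)]. *)
Lemma adj_IzP_PnE n (i j : 'I_#|{: Lw A n.+1}|) :
  \adj (IzP (Pn A P n.+1)) i j
  = overlap_poly (word i) (word j) * \det (IzP P)
    + 'X^n * (delta_u P (word j))%:P
      * \adj (IzP P) (last x0 (word i)) (head x0 (word j)).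
Proof.
elim: n i j => [|n IHn] i j.
  rewrite adj_IzP_Pn1 /overlap_poly size_word big_ord0 mul0r add0r mul1r.
  have := size_word j; case: (word j) => [|a []] //= _.
  by rewrite /delta_u big_nil mul1r.
have [k hk] := suffix_word i; have [l hl] := prefix_word j.
rewrite (adj_IzP_step hk hl) IHn det_IzP_Pn.
have [y hy] : exists y, word j = rcons (word l) y.
  have := size_word j; case/lastP: (word j) hl => // s y ->.
  rewrite size_rcons => -[ss]; exists y.
  by rewrite -!cats1 take_size_cat.
rewrite hy last_rcons (overlap_poly_rcons (n := n)) ?size_word // -hy.
rewrite (inj_eq (@word_inj _)) -hk hy delta_u_rcons ?size_word //.
have -> : head x0 (rcons (word l) y) = head x0 (word l).
  by have := size_word l; case: (word l).
have -> : last x0 (word i) = last x0 (word k).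
  by rewrite hk; have := size_word i; case: (word i) => [|a []].
rewrite mulrDl mulr_natl mulrDr -addrA !mulrA; congr (_ + (_ + _ * _)).
by rewrite polyCM exprS -!mulrA; congr (_ * _); rewrite mulrC -mulrA.
Qed.

End Words.

(** * Forbidding a single word *)

Theorem theorem4p12 (R : realFieldType) (N : nat) (A P : 'M[R]_N)
  (A01 : forall i j, A i j = 0 \/ A i j = 1)
  (Airr : irreducible A)
  (P_ge0 : forall i j, 0 <= P i j)
  (P_row : forall i, \sum_j P i j = 1)
  (P_supp : forall i j, 0 < P i j <-> A i j = 1)
  (r : nat) (hr : (2 <= r)%N) (u : r.-tuple 'I_N) (hu : allowed A u) :
  \det (1%:M - 'X *: map_mx polyC (hadamard (Bu A u r.-1) (Pn A P r.-1)))
  = f_u P u.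
Proof.
case: r hr u hu => [|[|n]] // _ u hu.
have x0 : 'I_N by case: u {hu} => -[].
have [i hi] : exists i : 'I_#|{: Lw A n.+2}|, word i = u.
  apply: (word_surj x0 P_ge0 P_row P_supp); first exact: size_tuple.
  exact/(allowedP x0 P_ge0 P_row P_supp).
have [l hl] := suffix_word x0 P_ge0 P_row P_supp i.
have [k hk] := prefix_word x0 P_ge0 P_row P_supp i.
pose p := P (last x0 (word k)) (last x0 (word i)).
(* The word [u] arises as [X * Y] only for [X] its prefix [k] and [Y] its suffix [l], so one entry,
   of value [p], is deleted. *)
have hB : hadamard (Bu A u n.+1) (Pn A P n.+1) = Pn A P n.+1 - p *: delta_mx k l.
  apply/matrixP=> a b; rewrite [LHS]mxE [RHS]mxE [X in _ = _ + X]mxE.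
  rewrite [X in _ = _ - X]mxE [X in _ = _ - _ * X]mxE.
  rewrite (Pn_word x0 P_ge0 P_row P_supp) (Bu_word x0 P_ge0 P_row P_supp) -hi.
  have -> : (a == k) && (b == l) = (word i == rcons (word a) (last x0 (word b)))
      && (behead (word a) == take n (word b)).
    rewrite -split_word_eq ?size_word // -hk -hl !(inj_eq (@word_inj _ _ _ _)).
    by rewrite !(eq_sym _ a) !(eq_sym _ b).
  case: eqP => _ /=; last by rewrite andbF !mul0r mulr0 subr0.
  rewrite andbT mul1r [rcons _ _ == _]eq_sym.
  case: (word i =P _) => [e|_] /=; last first.
    rewrite andbT mulr0 subr0; case: eqP => [_|/eqP ne]; first by rewrite mul1r.
    by rewrite (P_eq0 P_ge0 P_supp ne) mulr0.
  have -> : p = P (last x0 (word a)) (last x0 (word b)).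
    by rewrite /p hk e -cats1 take_size_cat ?size_word // last_cat.
  by rewrite andbF mul0r mulr1 subrr.
(* Deleting that entry adds [zp] to [1 - zP_(r-1)] at [(k, l)], hence [zp] times the adjugate entry
   [(l, k)] to [D]; the recursion gives the same value at [(u, u)]. *)
rewrite [LHS](_ : _ = \adj (IzP (Pn A P n.+2)) i i).
  rewrite (adj_IzP_PnE x0 P_ge0 P_row P_supp) hi /f_u.
  rewrite tilde_tau_uE ?size_tuple //=; congr (_ + _ * _).
  by case: (tval u) (size_tuple u).
rewrite hB (adj_IzP_step x0 P_ge0 P_row P_supp hl hk) eqxx mulr1n -/p.
rewrite -det_add_delta; congr (\det _); rewrite /IzP.
rewrite map_mxB map_mxZ map_delta_mx scalerBr scalerA opprB.
by rewrite [_ - 'X *: _]addrC addrA.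
Qed.
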